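(* Let $m\ge 1$ and let $a_1,a_2,\ldots,a_n$ ($n\ge 1$) be positive integers. The number of $m$-dimer covers of the snake graph $\mathcal{G}[a_1,a_2,\ldots,a_n]$ is equal to the top left entry (the $(1,1)$-entry) of the matrix product $\Lambda^{(m)}(a_1)\Lambda^{(m)}(a_2)\cdots\Lambda^{(m)}(a_n)$.
   Context: Snake graphs. A tile is a planar graph with four vertices and four edges having the shape of a (unit, axis-parallel) square. A snake graph is a connected planar graph consisting of a finite sequence of tiles $G_1,\ldots,G_d$ such that for each $i=1,\ldots,d-1$ the tiles $G_i$ and $G_{i+1}$ share exactly one edge $e_i$, and $e_i$ is either the north edge of $G_i$ and the south edge of $G_{i+1}$, or the east edge of $G_i$ and the west edge of $G_{i+1}$. A sign function on a snake graph is a map $f$ from its edges to $\{+,-\}$ such that on every tile the north and west edges have the same sign, the south and east edges have the same sign, and the north edge has sign opposite to the south edge. For positive integers $a_1,\ldots,a_n$ let $d=a_1+\cdots+a_n-1$ and let $(s_0,s_1,\ldots,s_d)$ be the sign sequence consisting of $a_1$ signs $-$, followed by $a_2$ signs $+$, followed by $a_3$ signs $-$, and so on alternately. Then $\mathcal{G}[a_1,\ldots,a_n]$ is the unique snake graph with $d$ tiles admitting a sign function $f$ with $f(e_0)=s_0$, where $e_0$ is the south edge of $G_1$, and $f(e_i)=s_i$ for $1\le i\le d-1$. If $d=0$, i.e. for $\mathcal{G}[1]$, the graph is a single edge with its two endpoints. An $m$-dimer cover of a graph is a multiset of edges such that every vertex is incident to exactly $m$ edges of the multiset (counted with multiplicity).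 Matrices. For a positive integer $a$ and $k\ge 1$ let $[\![a]\!]_k$ denote the number of $k$-dimer covers of $\mathcal{G}[a]$; set $[\![a]\!]_0=1$ and $[\![a]\!]_k=0$ for $k<0$. $\Lambda^{(m)}(a)$ is the $(m+1)\times(m+1)$ matrix whose $(i,j)$-entry is $[\![a]\!]_{m+2-i-j}$ for $1\le i,j\le m+1$. *)

(* Defs.v *)
From mathcomp Require Import all_boot all_order all_algebra.
From mathcomp Require Import classical_sets.

Set Implicit Arguments.
Unset Strict Implicit.
Unset Printing Implicit Defensive.

(* Graphs are given by finite edge lists: an edge is the pair of its end
   points, and the vertices are the end points of the edges. *)

Definition incident (V : eqType) (v : V) (e : V * V) : bool :=
  (v == e.1) || (v == e.2).

Definition vertices (V : eqType) (E : seq (V * V)) : seq V :=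
  undup (unzip1 E ++ unzip2 E).

(* A multiset of edges is its multiplicity function on the type of members of
   E (in which repetitions in the list E do not count). *)
Definition dimer_cover (V : choiceType) (E : seq (V * V)) (m : nat)
    (D : seq_sub E -> nat) : bool :=
  all (fun v => \sum_(e : seq_sub E | incident v (val e)) D e == m)
      (vertices E).

(* Restricting multiplicities to 0, ..., m loses no cover: see
   [dimer_cover_le]. *)
Definition num_dimer_covers (V : choiceType) (E : seq (V * V)) (m : nat) : nat :=
  #|[set D : {ffun seq_sub E -> 'I_m.+1} | dimer_cover m (fun e => D e : nat)]|.

Lemma dimer_cover_le (V : choiceType) (E : seq (V * V)) (m : nat)
    (D : seq_sub E -> nat) (e : seq_sub E) :
  dimer_cover m D -> D e <= m.
Proof.
move=> /allP /(_ (val e).1) H.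
have /H /eqP <- : (val e).1 \in vertices E.
  by rewrite mem_undup mem_cat map_f // ssvalP.
by rewrite (bigD1 e) ?leq_addr // /incident eqxx.
Qed.

(* Tiles are unit squares of the grid, denoted by their south-west corner; every
   edge is oriented towards the east or the north. *)

Notation point := (nat * nat)%type.
Notation edge := (point * point)%type.

Definition origin : point := (0, 0).

Definition south (p : point) : edge := (p, (p.1.+1, p.2)).
Definition north (p : point) : edge := ((p.1, p.2.+1), (p.1.+1, p.2.+1)).
Definition west (p : point) : edge := (p, (p.1, p.2.+1)).
Definition east (p : point) : edge := ((p.1.+1, p.2), (p.1.+1, p.2.+1)).

Definition tile_edges (p : point) : seq edge :=
  [:: south p; east p; north p; west p].

Definition glued (p q : point) : bool :=
  (north p == south q) || (east p == west q).

(* Snake graphs are considered up to translation: the first tile sits at the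
   origin. *)
Definition is_snake (t : seq point) : bool :=
  (head origin t == origin) && sorted glued t.

(* Without tiles, the graph is the single edge [south origin]; otherwise that
   edge is already the south edge of the first tile. *)
Definition snake_edges (t : seq point) : seq edge :=
  south origin :: flatten [seq tile_edges p | p <- t].

(* The edge e_i: the south edge of G_1 for i = 0, and the edge shared by G_i
   and G_(i+1) for 0 < i < d (the tile G_i is [nth origin t i.-1]). *)
Definition inner_edge (t : seq point) (i : nat) : edge :=
  if i is j.+1 then
    let p := nth origin t j in
    let q := nth origin t j.+1 in
    if north p == south q then north p else east p
  else south origin.

(* Signs are booleans: [true] is + and [false] is -.  The values of f at edges
   outside the snake graph are irrelevant. *)
Definition sign_function (t : seq point) (f : edge -> bool) : Prop :=
  forall p, p \in t ->
    [/\ f (north p) = f (west p),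
        f (south p) = f (east p)
      & f (north p) = ~~ f (south p)].

Fixpoint alternating_blocks (b : bool) (a : seq nat) : seq bool :=
  if a is k :: a' then nseq k b ++ alternating_blocks (~~ b) a' else [::].

Definition sign_seq (a : seq nat) : seq bool := alternating_blocks false a.

Definition is_cf_snake (a : seq nat) (t : seq point) : Prop :=
  [/\ is_snake t,
      size t = (sumn a).-1
    & exists f : edge -> bool,
      [/\ sign_function t f,
          f (inner_edge t 0) = nth false (sign_seq a) 0
        & forall i, 0 < i < size t ->
            f (inner_edge t i) = nth false (sign_seq a) i]].

(* The tiles of G[a_1, ..., a_n]; the default value [::] of [xget] is
   never used, by [is_cf_snake_unique]. *)
Definition cf_snake (a : seq nat) : seq point :=
  xget [::] [set t | is_cf_snake a t]%classic.

Fixpoint cf_tile (s : seq bool) (i : nat) : point :=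
  if i is j.+1 then
    let p := cf_tile s j in
    if nth false s j.+1 == nth false s 0 (+) odd j
    then (p.1.+1, p.2) else (p.1, p.2.+1)
  else origin.

Lemma cf_tile_sum s i : (cf_tile s i).1 + (cf_tile s i).2 = i.
Proof. by elim: i => //= i IH; case: ifP => _ /=; rewrite ?addnS ?addSn IH. Qed.

Lemma north_south (p q : point) :
  (north p == south q) = (q == (p.1, p.2.+1)).
Proof.
case: p q => [x y] [u v]; rewrite /north /south /=.
by apply/eqP/eqP => [[-> -> ]|[-> ->]].
Qed.

Lemma east_west (p q : point) :
  (east p == west q) = (q == (p.1.+1, p.2)).
Proof.
case: p q => [x y] [u v]; rewrite /east /west /=.
by apply/eqP/eqP => [[-> -> ]|[-> ->]].
Qed.

Lemma neq_up_right (p : point) : ((p.1.+1, p.2) == (p.1, p.2.+1)) = false.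
Proof. by apply/eqP => -[] /eqP; rewrite eq_sym -[X in X == _]addn0 -addn1 eqn_add2l. Qed.

Lemma cf_snakeE (a : seq nat) (t : seq point) :
  is_cf_snake a t <-> t = mkseq (cf_tile (sign_seq a)) (sumn a).-1.
Proof.
set s := sign_seq a; split.
  case=> /andP[/eqP t0 tg] szt [f [fs f0 fi]].
  suff H i : i < size t ->
      nth origin t i = cf_tile s i /\ f (south (nth origin t i)) = nth false s 0 (+) odd i.
    apply: (@eq_from_nth _ origin); first by rewrite size_mkseq.
    by move=> i it; rewrite nth_mkseq -?szt // (H i it).1.
  elim: i => [|i IH] it; first by rewrite nth0 t0 addbF.
  have {IH} [tE fE] := IH (ltnW it).
  have g := (sortedP origin tg) i it.
  have fie : f (inner_edge t i.+1) = nth false s i.+1 by apply: fi.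
  have [fn1 fs1 fo1] := fs _ (mem_nth origin (ltnW it)).
  have [fn2 fs2 fo2] := fs _ (mem_nth origin it).
  move: g fie; rewrite /inner_edge /glued /= -tE.
  set p := nth origin t i in tE fE fn1 fs1 fo1 *.
  set q := nth origin t i.+1 in fn2 fs2 fo2 *.
  have [ns _|_ /= /eqP ew] := eqVneq (north p) (south q).
    move=> fie; rewrite -fie fo1 fE -ns fo1 fE.
    move/eqP: ns; rewrite north_south => /eqP ->.
    by case: (nth _ _ 0); case: (odd i).
  move=> fie; rewrite -fie -fs1 fE eqxx.
  have := fo2; rewrite fn2 -ew -fs1 fE.
  move/eqP: ew; rewrite east_west => /eqP -> h; split=> //.
  by move: h; case: (f _); case: (nth _ _ 0); case: (odd i).
move=> ->; set d := (sumn a).-1; split.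
- apply/andP; split; first by case: d.
  apply/(sortedP origin) => i; rewrite size_mkseq => id.
  rewrite !nth_mkseq ?(ltnW id) // /glued north_south east_west /=.
  by case: ifP; rewrite eqxx ?orbT.
- by rewrite size_mkseq.
pose f (e : edge) := nth false s 0 (+) odd (e.1.1 + e.1.2)
  (+) (e.1.1 == e.2.1).
have neS (x : nat) : (x == x.+1) = false by elim: x.
exists f; split.
- move=> p _; rewrite /f /= ?addSn ?addnS ?eqxx ?neS /=.
  by split; case: (nth _ _ 0); case: (odd _).
- by rewrite /f /= !addbF.
case=> // i; rewrite size_mkseq => id.
rewrite /inner_edge !nth_mkseq ?(ltnW id) // north_south /=.
have := cf_tile_sum s i; set p := cf_tile s i => pE.
have [->|ne] := eqVneq (nth false s i.+1) (nth false s 0 (+) odd i).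
  by rewrite neq_up_right /f /= pE eqxx /=; case: (nth _ _ 0); case: (odd i).
rewrite eqxx /f /= addnS pE neS /=.
by move: ne; case: (nth _ _ 0); case: (odd i); case: (nth _ _ i.+1).
Qed.

Lemma is_cf_snake_unique (a : seq nat) : exists! t, is_cf_snake a t.
Proof.
exists (mkseq (cf_tile (sign_seq a)) (sumn a).-1); split; first exact/cf_snakeE.
by move=> t /cf_snakeE ->.
Qed.

Lemma cf_snakeP (a : seq nat) : is_cf_snake a (cf_snake a).
Proof.
have [t [ta _]] := is_cf_snake_unique a.
exact: (@xgetPex _ [::] [set t | is_cf_snake a t]%classic (ex_intro _ t ta)).
Qed.

(* The edges of G[a_1, ..., a_n]. *)
Definition cf_graph (a : seq nat) : seq edge := snake_edges (cf_snake a).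

Definition bracket (a : nat) (k : int) : nat :=
  match k with
  | Posz 0 => 1
  | Posz k' => num_dimer_covers (cf_graph [:: a]) k'
  | Negz _ => 0
  end.

Local Open Scope ring_scope.

(* Indices are 0-based, so the exponent m+2-i-j reads m-i-j, computed in int. *)
Definition Lambda (m a : nat) : 'M[int]_m.+1 :=
  \matrix_(i, j) (bracket a (m%:Z - (i : nat)%:Z - (j : nat)%:Z))%:Z.

(* Main.v *)
Require Import Defs.
From mathcomp Require Import all_boot all_order all_algebra.
From mathcomp Require Import fingroup perm zify.

Set Implicit Arguments.
Unset Strict Implicit.
Unset Printing Implicit Defensive.

Import GRing.Theory.

Local Open Scope nat_scope.

(** The proof is a transfer matrix computation along the snake.

Let [e_i] be the edge by which the snake enters its tile [i] (counted from 0),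
and let [r_i] be the row vector whose entry [k] is the number of m-covers of
the part of the snake before that tile in which [e_i] has multiplicity [k].
In a new tile put [e_i = uv], let [uu'] and [vv'] be the sides adjacent to
[e_i], and [u'v'] the side opposite to it. The vertices [u'] and [v'] are new,
so in a cover both adjacent sides have the same multiplicity [k] and the
opposite side has [m - k]. Adding [k] to the multiplicity of [e_i] and
forgetting the new sides then gives a cover of the old part in which [e_i] has
multiplicity at least [k], and this can be undone ([count_covers_side],
[count_covers_opposite]). Hence [r_(i+1)] is [r_i T] if the snake leaves
through an adjacent side, and [r_i T J] if it goes straight on, where
[T j k = 1] for [k <= j] and [0] otherwise, and [J] reverses the indices 0 to m
([port_rowS]; [T] is [transfer], [J] is [reversal]). The row [r_0] is the first
row of [J], because the edge [e_0] alone must have multiplicity [m].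

The snake goes straight on exactly when the sign changes, so in terms of the
signs the number of covers is the (0, 0) entry of a product with one factor [T]
per sign and one factor [J] before each block of equal signs, the first [J]
coming from [r_0]
([num_dimer_covers_signs], [prod_alternating_blocks]): it is the (0, 0) entry of
the product of the matrices [J T^a_k] ([num_dimer_covers_cf]).

It remains to see that [J T^a] is the matrix of the theorem ([Lambda_transfer]).
The entry (x, y) of [T^a] counts weakly decreasing chains of [a] steps from [x]
to [y], so it depends only on [x - y] and not on the size of the matrix
([transferXE]). By the formula already proved, now for a single block and [k]
in place of [m], the number of chains descending by [k] is the number of
k-dimer covers of the snake graph of [[a]]. *)

(** * Covers as weights on all pairs of vertices *)

Section Weights.
Variables (V : choiceType) (m : nat).
Implicit Types (E : seq (V * V)) (w : V * V -> nat) (Q : pred nat) (e : V * V).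

(** Covers of different edge lists have different types; functions on all pairs
of vertices give a common type in which a cover can be extended or restricted,
and only their values on the list matter. The [undup] makes a repeated entry
count as one edge. *)
Definition degree E w v := \sum_(e <- undup E) incident v e * w e.

Definition covers E w := all (fun v => degree E w v == m) (vertices E).

Definition weight E (D : {ffun seq_sub E -> 'I_m.+1}) e : nat :=
  if insub e is Some x then D x else 0.

Definition restrict E w : {ffun seq_sub E -> 'I_m.+1} :=
  [ffun x => inord (w (val x))].

Definition count_covers E e Q :=
  #|[set D : {ffun seq_sub E -> 'I_m.+1} |
      covers E (weight D) && Q (weight D e)]|.

Lemma weight_val E (D : {ffun seq_sub E -> 'I_m.+1}) (x : seq_sub E) :
  weight D (val x) = D x.
Proof. by rewrite /weight valK. Qed.

Lemma mem_vertices E v :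
  reflect (exists2 e, e \in E & incident v e) (v \in vertices E).
Proof.
rewrite mem_undup mem_cat; apply: (iffP orP).
  by case=> /mapP[e eE ->]; exists e => //; rewrite /incident eqxx ?orbT.
by case=> e eE /orP[] /eqP ->; [left | right]; apply: map_f.
Qed.

Lemma sum_seq_sub E w v :
  \sum_(x : seq_sub E | incident v (val x)) w (val x) = degree E w v.
Proof.
rewrite big_mkcond /=.
under eq_bigr => x _ do
  rewrite -[if _ then _ else _]/(if incident v (val x) then w (val x) else 0)
          -[if _ then _ else _]mulnbl.
rewrite -(big_map val predT (fun e => incident v e * w e)); apply: perm_big.
apply: uniq_perm; rewrite ?undup_uniq ?(map_inj_uniq val_inj) ?index_enum_uniq //.
move=> e; rewrite mem_undup; apply/mapP/idP => [[x _ ->]|eE]; first exact: valP.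
by exists (SeqSub eE) => //; rewrite mem_index_enum.
Qed.

Lemma dimer_coverE E (D : {ffun seq_sub E -> 'I_m.+1}) :
  dimer_cover m (fun x => D x : nat) = covers E (weight D).
Proof.
apply: eq_all => v; congr (_ == m); rewrite -sum_seq_sub.
by apply: eq_bigr => x _; rewrite weight_val.
Qed.

Lemma eq_degree E w1 w2 v :
  {in E, w1 =1 w2} -> degree E w1 v = degree E w2 v.
Proof.
move=> eqw; rewrite /degree big_seq [RHS]big_seq.
by apply: eq_bigr => e; rewrite mem_undup => /eqw ->.
Qed.

Lemma eq_covers E w1 w2 : {in E, w1 =1 w2} -> covers E w1 = covers E w2.
Proof. by move=> eqw; apply: eq_all => v; rewrite (eq_degree v eqw). Qed.

Lemma covers_le E w e : covers E w -> e \in E -> w e <= m.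
Proof.
move=> /allP cw eE; have inc : incident e.1 e by rewrite /incident eqxx.
have /cw/eqP <- : e.1 \in vertices E by apply/mem_vertices; exists e.
by rewrite /degree (bigD1_seq e) ?mem_undup ?undup_uniq //= inc mul1n leq_addr.
Qed.

Lemma restrictK E w : covers E w -> {in E, weight (restrict E w) =1 w}.
Proof.
move=> cw e eE; rewrite -[e]/(val (SeqSub eE)) weight_val ffunE inordK //.
by rewrite ltnS; exact: covers_le cw eE.
Qed.

(** Covers are compared through maps of weights that are injective on covers up
to their values outside the edge list. *)
Lemma leq_count_covers E E' e e' Q Q' (phi : (V * V -> nat) -> V * V -> nat) :
    e' \in E' ->
    (forall w, covers E w -> Q (w e) -> covers E' (phi w) /\ Q' (phi w e')) ->
    (forall w1 w2, covers E w1 -> Q (w1 e) -> covers E w2 -> Q (w2 e) ->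
      {in E', phi w1 =1 phi w2} -> {in E, w1 =1 w2}) ->
  count_covers E e Q <= count_covers E' e' Q'.
Proof.
move=> e'E' phiP phiI.
pose F (D : {ffun seq_sub E -> 'I_m.+1}) := restrict E' (phi (weight D)).
rewrite /count_covers -(card_in_imset (f := F)).
  apply/subset_leq_card/subsetP => D' /imsetP[D].
  rewrite inE => /andP[cD QD] ->; have [c' q'] := phiP _ cD QD.
  by rewrite inE (eq_covers (restrictK c')) c' (restrictK c').
move=> D1 D2; rewrite !inE => /andP[c1 q1] /andP[c2 q2] eqF.
have [c1' _] := phiP _ c1 q1; have [c2' _] := phiP _ c2 q2.
apply/ffunP => x; apply/val_inj; rewrite /= -!weight_val.
apply: phiI => //; last exact: valP.
by move=> f fE'; rewrite -(restrictK c1') // -(restrictK c2') // -/(F D1) eqF.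
Qed.

Lemma num_dimer_covers_count E e :
  num_dimer_covers E m = count_covers E e predT.
Proof. by apply: eq_card => D; rewrite !inE dimer_coverE andbT. Qed.

Lemma count_covers_sum E e Q : e \in E ->
  count_covers E e Q = \sum_(j < m.+1 | Q j) count_covers E e (pred1 (j : nat)).
Proof.
move=> eE; rewrite /count_covers -sum1_card.
rewrite (partition_big (fun D => inord (weight D e) : 'I_m.+1) (fun j => Q j)) /=.
  apply: eq_bigr => j Qj; rewrite -sum1_card; apply: eq_bigl => D; rewrite !inE.
  case cD: covers => //=; rewrite -val_eqE /= inordK ?ltnS ?(covers_le cD) //.
  by case: eqP => [->|]; rewrite ?Qj ?andbF.
by move=> D; rewrite inE => /andP[cD QD]; rewrite inordK ?ltnS ?(covers_le cD).
Qed.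

(** * Gluing a tile to an edge *)

Section GlueTile.
Variables (E E' : seq (V * V)) (u v u' v' : V).
Hypotheses (uvE : (u, v) \in E) (neq_uv : u != v) (neq_uv' : u' != v').
Hypotheses (u'E : u' \notin vertices E) (v'E : v' \notin vertices E).
Hypothesis memE' : E' =i [:: (u, u'), (v, v'), (u', v') & E].

Let notin_E x y : (x \notin vertices E) || (y \notin vertices E) -> (x, y) \notin E.
Proof.
move=> xyE; apply/negP => inE; case/orP: xyE => /mem_vertices; apply;
  by exists (x, y) => //; rewrite /incident eqxx ?orbT.
Qed.

Let uE : u \in vertices E.
Proof. by apply/mem_vertices; exists (u, v); rewrite // /incident eqxx. Qed.

Let vE : v \in vertices E.
Proof. by apply/mem_vertices; exists (u, v); rewrite // /incident eqxx orbT. Qed.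

Let neqE x y : x \in vertices E -> y \notin vertices E -> (x == y) = false.
Proof. by move=> xE; apply: contraNF => /eqP <-. Qed.

Let uu'E : (u, u') \notin E. Proof. by rewrite notin_E ?u'E ?orbT. Qed.
Let vv'E : (v, v') \notin E. Proof. by rewrite notin_E ?v'E ?orbT. Qed.
Let u'v'E : (u', v') \notin E. Proof. by rewrite notin_E ?v'E ?orbT. Qed.

Let incE := (neqE uE u'E, neqE uE v'E, neqE vE u'E, neqE vE v'E).

Lemma degree_glue w x :
  degree E' w x = incident x (u, u') * w (u, u') + incident x (v, v') * w (v, v')
                  + incident x (u', v') * w (u', v') + degree E w x.
Proof.
have pE : perm_eq (undup E') [:: (u, u'), (v, v'), (u', v') & undup E].
  apply: uniq_perm; first exact: undup_uniq.
    rewrite /= !inE !mem_undup (negPf uu'E) (negPf vv'E) u'v'E undup_uniq.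
    by rewrite !xpair_eqE (negPf neq_uv) !incE.
  by move=> f; rewrite mem_undup memE' !inE mem_undup.
rewrite /degree (perm_big _ pE) !big_cons.
by rewrite /= !addnA.
Qed.

Lemma degree_notin w x : x \notin vertices E -> degree E w x = 0.
Proof.
move=> xE; rewrite /degree big_seq big1 // => e; rewrite mem_undup => eE.
case inc: incident => //; case/negP: xE; apply/mem_vertices; by exists e.
Qed.

Lemma degree_shift w1 w2 k x :
    {in E, forall e, w1 e = w2 e + (e == (u, v)) * k} ->
  degree E w1 x = degree E w2 x + incident x (u, v) * k.
Proof.
move=> eqw; rewrite (eq_degree x eqw) /degree.
under eq_bigr do rewrite mulnDr.
rewrite big_split /=; congr (_ + _).
rewrite (bigD1_seq (u, v)) ?mem_undup ?undup_uniq //= eqxx mul1n big1 ?addn0 //.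
by move=> e /negPf ->; rewrite muln0.
Qed.

Let degree_old w x : x \in vertices E ->
  degree E' w x = (x == u) * w (u, u') + (x == v) * w (v, v') + degree E w x.
Proof.
move=> xE; rewrite degree_glue /incident /=.
by rewrite (neqE xE u'E) (neqE xE v'E) !orbF !mul0n addn0.
Qed.

Let degree_u' w : degree E' w u' = w (u, u') + w (u', v').
Proof.
rewrite degree_glue degree_notin // /incident /= eqxx !(eq_sym u') !incE.
by rewrite (eq_sym v') (negPf neq_uv') /= !mul1n addn0 addn0.
Qed.

Let degree_v' w : degree E' w v' = w (v, v') + w (u', v').
Proof.
rewrite degree_glue degree_notin // /incident /= eqxx !(eq_sym v') !incE.
by rewrite (negPf neq_uv') /= !mul1n addn0.
Qed.

Let verticesE' x : x \in vertices E' = [|| x == u', x == v' | x \in vertices E].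
Proof.
apply/mem_vertices/idP => [[e]|].
  rewrite memE' !inE => /or4P[/eqP->|/eqP->|/eqP->|eE]; rewrite /incident /=.
  - by case/orP => /eqP ->; rewrite ?eqxx ?uE ?orbT.
  - by case/orP => /eqP ->; rewrite ?eqxx ?vE ?orbT.
  - by case/orP => /eqP ->; rewrite ?eqxx ?orbT.
  by move=> inc; apply/orP; right; apply/orP; right; apply/mem_vertices; exists e.
case/or3P => [/eqP->|/eqP->|/mem_vertices[e eE inc]].
- by exists (u', v'); rewrite ?memE' ?inE /incident eqxx ?orbT.
- by exists (u', v'); rewrite ?memE' ?inE /incident eqxx ?orbT.
by exists e; rewrite // memE' !inE eE !orbT.
Qed.

(** These are the conditions at [u'] and [v'], which meet two edges each. *)
Lemma covers_glue_new w : covers E' w ->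
  w (u, u') = w (v, v') /\ w (v, v') + w (u', v') = m.
Proof.
move=> /allP cw.
have := cw u'; rewrite verticesE' eqxx degree_u' => /(_ isT)/eqP h1.
have := cw v'; rewrite verticesE' eqxx orbT degree_v' => /(_ isT)/eqP h2.
by split=> //; apply/eqP; rewrite -(eqn_add2r (w (u', v'))) h1 h2.
Qed.

(** At [u] and [v], and nowhere else among the old vertices, the new adjacent
sides bring [k], exactly what [uv] loses. *)
Lemma covers_glue w' w k :
    w' (u, u') = k -> w' (v, v') = k -> k + w' (u', v') = m ->
    {in E, forall e, w e = w' e + (e == (u, v)) * k} ->
  covers E' w' = covers E w.
Proof.
move=> wa wb wo shift.
have old x : x \in vertices E -> degree E' w' x = degree E w x.
  move=> xE; rewrite degree_old // (degree_shift x shift) wa wb addnC -mulnDl.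
  congr (_ + _ * k); rewrite /incident /=.
  by case: (eqVneq x u) neq_uv => [->|_] //= /negPf ->.
apply/allP/allP => cw x xE.
  by rewrite -old //; apply: cw; rewrite verticesE' xE !orbT.
move: xE; rewrite verticesE' => /or3P[/eqP->|/eqP->|xE].
- by rewrite degree_u' wa wo.
- by rewrite degree_v' wb wo.
by rewrite old // cw.
Qed.

(** Moving [k] units from [uv] to each adjacent side is possible exactly when
[uv] carries at least [k], and the multiplicities of the new sides are then
forced. *)
Lemma count_covers_side k : k <= m ->
  count_covers E' (v, v') (pred1 k) = count_covers E (u, v) (leq k).
Proof.
move=> km; apply/eqP; rewrite eqn_leq; apply/andP; split.
  (* From the larger graph to E: move the k units back to uv. *)
  pose psi (w : V * V -> nat) e := w e + (e == (u, v)) * k.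
  apply: (leq_count_covers (phi := psi)) => // [w cw|w1 w2].
    move=> /eqP wb; have [wa wo] := covers_glue_new cw.
    rewrite /psi eqxx mul1n leq_addl; split=> //.
    by rewrite -(covers_glue (w' := w) (k := k)) // ?wa // -wb.
  move=> c1 /eqP b1 c2 /eqP b2 eqpsi e.
  have [a1 o1] := covers_glue_new c1; have [a2 o2] := covers_glue_new c2.
  rewrite memE' !inE => /or4P[/eqP->|/eqP->|/eqP->|eE].
  - by rewrite a1 a2 b1 b2.
  - by rewrite b1 b2.
  - by apply/(@addnI k); rewrite -[in LHS]b1 o1 -b2 o2.
  exact: addIn (eqpsi e eE).
(* From E to the larger graph: move k units from uv to the adjacent sides. *)
pose phi (w : V * V -> nat) e :=
  if (e == (u, u')) || (e == (v, v')) then k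
  else if e == (u', v') then m - k else w e - (e == (u, v)) * k.
have phiE w e : e \in E -> phi w e = w e - (e == (u, v)) * k.
  move=> eE; rewrite /phi; have neq x : x \notin E -> (e == x) = false.
    by apply: contraNF => /eqP <-.
  by rewrite (neq _ uu'E) (neq _ vv'E) (neq _ u'v'E).
have phib w : phi w (v, v') = k by rewrite /phi eqxx orbT.
apply: (leq_count_covers (phi := phi)) => [|w cw kw|w1 w2 _ k1 _ k2 eqphi e eE].
- by rewrite memE' !inE eqxx orbT.
- rewrite phib /= eqxx; split=> //.
  rewrite (covers_glue (w := w) (k := k)) //.
  + by rewrite /phi eqxx.
  + by rewrite /phi !xpair_eqE !(eq_sym u') !incE /= eqxx eqxx subnKC.
  move=> e eE; rewrite phiE //; case: eqP => [->|_]; last by rewrite subn0 addn0.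
  by rewrite mul1n subnK.
have := eqphi e; rewrite memE' !inE eE !orbT !phiE // => /(_ isT).
case: eqP => [->|_]; last by rewrite mul0n !subn0.
by rewrite mul1n => /(congr1 (addn k)); rewrite !subnKC.
Qed.

Lemma count_covers_opposite k : k <= m ->
  count_covers E' (u', v') (pred1 (m - k)) = count_covers E (u, v) (leq k).
Proof.
move=> km; rewrite -count_covers_side //; apply: eq_card => D; rewrite !inE.
case cD: covers => //=; have [_] := covers_glue_new cD.
move=> ym; by rewrite -(eqn_add2r k) subnK // -[X in _ == X]ym addnC eqn_add2r eq_sym.
Qed.

End GlueTile.
End Weights.

(** * The tiles of a snake *)

Section SnakePorts.
Variable s : seq bool.

(** With [false] for east and [true] for north, this is the direction of the
step of [cf_tile] into tile [i]; at [i = 0] it is [true], in agreement with the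
convention that [e_0] is the south edge of the first tile. *)
Definition enters_south i := nth false s i == nth false s 0 (+) odd i.

Definition port i : edge :=
  if enters_south i then south (cf_tile s i) else west (cf_tile s i).

Definition partial_snake i : seq edge := snake_edges (mkseq (cf_tile s) i).

Lemma portS i :
  port i.+1 = if enters_south i.+1 then north (cf_tile s i) else east (cf_tile s i).
Proof.
rewrite /port /enters_south /=.
by case: (nth _ s i.+1); case: (nth _ s 0); case: (odd i).
Qed.

(** The snake goes straight on at a tile exactly when the sign changes. *)
Lemma enters_southS i : (enters_south i == enters_south i.+1) =
  (nth false s i != nth false s i.+1).
Proof.
rewrite /enters_south /=.
by case: (nth _ s i.+1); case: (nth _ s i); case: (nth _ s 0); case: (odd i).
Qed.

Lemma mem_partial_snakeS i e : e \in partial_snake i.+1 =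
  (e \in tile_edges (cf_tile s i)) || (e \in partial_snake i).
Proof.
rewrite /partial_snake /snake_edges mkseqS map_rcons flatten_rcons.
by rewrite in_cons mem_cat [in RHS]in_cons orbA orbC.
Qed.

Lemma mem_port i : port i \in partial_snake i.
Proof.
case: i => [|i]; first by rewrite /port /enters_south addbF eqxx mem_head.
by rewrite mem_partial_snakeS portS !inE; case: ifP; rewrite eqxx ?orbT.
Qed.

(** This shows that two vertices of tile [i] are new: the corners other than the
ends of the port have coordinate sums [i + 1] and [i + 2], while the earlier
tiles reach the sum [i + 1] only at their last north-east corner, which is the
far end of the port. *)
Lemma vertices_partial_snake i v : v \in vertices (partial_snake i) ->
  v.1 + v.2 <= i \/ v = (port i).2.
Proof.
elim: i v => [|i IH] v.
  rewrite /port /enters_south addbF eqxx.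
  case/mem_vertices=> e; rewrite inE => /eqP -> /orP[] /eqP ->; first by left.
  by right.
case/mem_vertices=> e; rewrite mem_partial_snakeS => /orP[eT|eE] inc; last first.
  have /IH[vi|->] : v \in vertices (partial_snake i) by apply/mem_vertices; exists e.
    by left; apply: leqW.
  left; have := cf_tile_sum s i; rewrite /port; case: ifP => _ /=; lia.
have pE := cf_tile_sum s i; rewrite portS.
set p := cf_tile s i in eT pE *.
have -> : (if enters_south i.+1 then north p else east p).2 = (p.1.+1, p.2.+1) by case: ifP.
move: eT inc; rewrite !inE /incident.
by case/or4P => /eqP -> /= /orP[] /eqP ->; rewrite /=; ((left; lia) || by right).
Qed.

(** The multiplicity of the next port is [k] if that port is adjacent to the
present one in the tile between them, and [m - k] if it is opposite. *)
Lemma count_covers_partial_snakeS m i k : k <= m ->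
  count_covers m (partial_snake i.+1) (port i.+1)
    (pred1 (if nth false s i == nth false s i.+1 then k else m - k)) =
  count_covers m (partial_snake i) (port i) (leq k).
Proof.
move=> km; have pE := cf_tile_sum s i; rewrite portS.
have E'E := mem_partial_snakeS i; have portE := mem_port i.
have vE := @vertices_partial_snake i.
have := enters_southS i; move: portE vE; rewrite /port.
set p := cf_tile s i in pE E'E *.
set E := partial_snake i in E'E *; set E' := partial_snake i.+1 in E'E *.
clearbody E E' p.
have old (x : point) (e : edge) :
    (forall v, v \in vertices E -> v.1 + v.2 <= i \/ v = e.2) ->
    i < x.1 + x.2 -> x != e.2 -> x \notin vertices E.
  by move=> vE ix /eqP xe; apply/negP => /vE[|//]; rewrite leqNgt ix.
have sw : p != (p.1.+1, p.2) by rewrite [p]surjective_pairing xpair_eqE /=; lia.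
have sn : p != (p.1, p.2.+1) by rewrite [p]surjective_pairing xpair_eqE /=; lia.
case: (enters_south i) => portE vE.
  (* Entering from the south: u' and v' are the upper corners. *)
  have memE : E' =i [:: (p, (p.1, p.2.+1)), ((p.1.+1, p.2), (p.1.+1, p.2.+1)),
      ((p.1, p.2.+1), (p.1.+1, p.2.+1)) & E].
    move=> e; rewrite E'E !inE -/(west p) -/(east p) -/(north p).
    case: (eqVneq e (south p)) => [->|_]; first by rewrite portE !orbT.
    by case: (e == west p); case: (e == east p); case: (e == north p).
  have nu : (p.1, p.2.+1) \notin vertices E.
    by apply: (old _ _ vE); rewrite /= ?xpair_eqE; lia.
  have nv : (p.1.+1, p.2.+1) \notin vertices E.
    by apply: (old _ _ vE); rewrite /= ?xpair_eqE; lia.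
  have neq : (p.1, p.2.+1) != (p.1.+1, p.2.+1) by rewrite xpair_eqE; lia.
  case: (enters_south i.+1); case: (nth _ _ i == _) => //= _.
    exact: (count_covers_opposite (m := m) portE sw neq nu nv memE km).
  exact: (count_covers_side (m := m) portE sw neq nu nv memE km).
(* Entering from the west: u' and v' are the right-hand corners. *)
have memE : E' =i [:: (p, (p.1.+1, p.2)), ((p.1, p.2.+1), (p.1.+1, p.2.+1)),
    ((p.1.+1, p.2), (p.1.+1, p.2.+1)) & E].
  move=> e; rewrite E'E !inE -/(south p) -/(east p) -/(north p).
  case: (eqVneq e (west p)) => [->|_]; first by rewrite portE !orbT.
  by case: (e == south p); case: (e == east p); case: (e == north p).
have nu : (p.1.+1, p.2) \notin vertices E.
  by apply: (old _ _ vE); rewrite /= ?xpair_eqE; lia.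
have nv : (p.1.+1, p.2.+1) \notin vertices E.
  by apply: (old _ _ vE); rewrite /= ?xpair_eqE; lia.
have neq : (p.1.+1, p.2) != (p.1.+1, p.2.+1) by rewrite xpair_eqE; lia.
case: (enters_south i.+1); case: (nth _ _ i == _) => //= _.
  exact: (count_covers_side (m := m) portE sn neq nu nv memE km).
exact: (count_covers_opposite (m := m) portE sn neq nu nv memE km).
Qed.

End SnakePorts.

(** The snake without tiles, from which the recursion starts. *)
Lemma count_covers_edge (V : choiceType) m (e : V * V) k :
  count_covers m [:: e] e (pred1 k) = (k == m).
Proof.
have cE w : covers m [:: e] w = (w e == m).
  have e1 : e.1 \in vertices [:: e].
    by apply/mem_vertices; exists e; rewrite ?mem_head // /incident eqxx.
  rewrite /covers; have dE v : v \in vertices [:: e] -> degree [:: e] w v = w e.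
    case/mem_vertices=> f; rewrite inE => /eqP -> inc.
    by rewrite /degree /= big_seq1 inc mul1n.
  apply/allP/eqP => [/(_ _ e1)|we v /dE ->]; last by rewrite we.
  by rewrite dE // => /eqP.
rewrite /count_covers; have [->|km] := eqVneq k m; last first.
  apply/eqP; rewrite cards_eq0; apply/eqP/setP => D; rewrite !inE cE /=.
  by case: eqP => // ->; rewrite eq_sym (negPf km).
rewrite (_ : [set _ | _] = [set [ffun=> ord_max]]) ?cards1 //.
apply/setP => D; rewrite !inE cE andbb.
have eE : e \in [:: e] by rewrite mem_head.
rewrite -[X in weight _ X]/(val (SeqSub eE)) weight_val.
apply/eqP/eqP => [De|->]; last by rewrite ffunE.
apply/ffunP => x; rewrite ffunE; apply/val_inj; rewrite /= -[RHS]De.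
congr (nat_of_ord (D _)); by apply/val_inj; have := valP x; rewrite inE => /eqP.
Qed.

Local Open Scope ring_scope.

(** * Transfer matrices *)

Section TransferMatrices.
Variable m : nat.

Definition transfer : 'M[int]_m.+1 := \matrix_(j, k) (k <= j)%N%:R.

Definition reversal : 'M[int]_m.+1 := perm_mx (perm (@rev_ord_inj m.+1)).

(** Conjugation by [J] exchanges the lower and upper triangular matrices of ones.
With the signs absorbed in this way, the matrix attached to a sign no longer
depends on the neighbouring signs. *)
Definition signed_transfer (b : bool) : 'M[int]_m.+1 :=
  reversal ^+ b * transfer * reversal ^+ b.

Lemma reversal_mulE p (A : 'M[int]_(m.+1, p)) i j :
  (reversal *m A) i j = A (rev_ord i) j.
Proof. by rewrite -row_permE mxE permE. Qed.

Lemma mul_reversalE p (A : 'M[int]_(p, m.+1)) i j :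
  (A *m reversal) i j = A i (rev_ord j).
Proof.
have JV : ((perm (@rev_ord_inj m.+1))^-1 = perm (@rev_ord_inj m.+1))%g.
  apply/eqP; rewrite eq_invg_mul; apply/eqP/permP => x.
  by rewrite permM !permE rev_ordK.
by rewrite /reversal -JV -col_permE mxE permE.
Qed.

Lemma reversalK : reversal * reversal = 1.
Proof.
apply/matrixP => i j; rewrite -mulmxE reversal_mulE /reversal !mxE permE.
by rewrite rev_ordK.
Qed.

Lemma reversal_addb (b c : bool) : reversal ^+ b * reversal ^+ c = reversal ^+ (b (+) c).
Proof. by case: b; case: c; rewrite /= ?expr1 ?expr0 ?mulr1 ?mul1r ?reversalK. Qed.

Lemma signed_transferX (b : bool) k :
  signed_transfer b ^+ k = reversal ^+ b * transfer ^+ k * reversal ^+ b.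
Proof.
elim: k => [|k IH]; first by rewrite !expr0 mulr1 reversal_addb addbb.
rewrite exprS IH exprS /signed_transfer !mulrA -(mulrA _ (reversal ^+ b) (reversal ^+ b)).
by rewrite reversal_addb addbb mulr1.
Qed.

(** Where two blocks meet, the factors [J^b] and [J^(~~ b)] combine to a
single [J]; inside a block they cancel. *)
Lemma prod_alternating_blocks b a :
  \prod_(c <- alternating_blocks b a) signed_transfer c =
  reversal ^+ b * \prod_(k <- a) (transfer ^+ k * reversal)
    * reversal ^+ (b (+) odd (size a)).
Proof.
elim: a b => [|k a IH] b /=.
  by rewrite !big_nil mulr1 addbF reversal_addb addbb.
rewrite big_cat IH big_cons /= big_nseq.
have -> : iter k ( *%R (signed_transfer b)) 1 = signed_transfer b ^+ k.
  by elim: k => //= k ->; rewrite exprS.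
rewrite signed_transferX addNb -addbN !mulrA.
by rewrite -(mulrA _ (reversal ^+ b)) reversal_addb addbN addbb.
Qed.

Definition port_row s i : 'rV[int]_m.+1 :=
  \row_k (count_covers m (partial_snake s i) (port s i) (pred1 (k : nat)))%:R.

Lemma port_row0 s : port_row s 0 = row ord0 reversal.
Proof.
apply/rowP => k; rewrite !mxE permE /port /enters_south addbF eqxx.
rewrite count_covers_edge -val_eqE /= subn1 /=; by rewrite eq_sym.
Qed.

(** Multiplication by [T] takes tail sums. The entry 0 is the sum of the whole
row, which counts all covers. *)
Lemma port_row_transferE s i k : (port_row s i *m transfer) ord0 k =
  (count_covers m (partial_snake s i) (port s i) (leq k))%:R.
Proof.
rewrite (count_covers_sum _ _ (mem_port s i)) natr_sum big_mkcond mxE.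
by apply: eq_bigr => j _; rewrite !mxE; case: leqP; rewrite ?mulr1 ?mulr0.
Qed.

Lemma port_rowS s i : port_row s i.+1 =
  port_row s i *m (transfer * reversal ^+ (nth false s i (+) nth false s i.+1)).
Proof.
apply/rowP => k; rewrite mulmxA mxE.
have := @count_covers_partial_snakeS s m i; rewrite -negb_eqb.
case: eqP => _ H.
  by rewrite expr0 mulmx1 port_row_transferE -H // -ltnS.
rewrite expr1 mul_reversalE port_row_transferE -H /=; last by lia.
by rewrite subSS subKn // -ltnS.
Qed.

Lemma port_rowE s i : port_row s i =
  row ord0 (reversal * reversal ^+ nth false s 0
    * \prod_(0 <= j < i) signed_transfer (nth false s j)
    * reversal ^+ nth false s i).
Proof.
elim: i => [|i IH].
  by rewrite port_row0 big_nil mulr1 -mulrA reversal_addb addbb mulr1.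
rewrite port_rowS IH -row_mul mulmxE big_nat_recr //= -!reversal_addb.
by rewrite /signed_transfer !mulrA.
Qed.

(** The last port may be either side of the last tile; taking the whole sum of
the row is one more factor [T], so that every sign, the last one included,
contributes a factor. *)
Lemma num_dimer_covers_signs s : (0 < size s)%N ->
  (num_dimer_covers (partial_snake s (size s).-1) m)%:R =
  (reversal * reversal ^+ nth false s 0 * \prod_(b <- s) signed_transfer b
    * reversal ^+ last false s) ord0 ord0.
Proof.
move=> s0; rewrite (num_dimer_covers_count _ _ (port s (size s).-1)).
rewrite -[count_covers _ _ _ _]/(count_covers m _ _ (leq (ord0 : 'I_m.+1))).
rewrite -port_row_transferE port_rowE -row_mul mulmxE mxE.
rewrite (big_nth false) -[in RHS](prednK s0) big_nat_recr //= nth_last.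
by rewrite /signed_transfer -!mulrA reversal_addb addbb mulr1 !mulrA.
Qed.

End TransferMatrices.

(** * From signs to blocks *)

Lemma size_alternating_blocks b a : size (alternating_blocks b a) = sumn a.
Proof. by elim: a b => //= k a IH b; rewrite size_cat size_nseq IH. Qed.

Lemma last_alternating_blocks b c a : (0 < size a)%N -> all (leq 1) a ->
  last c (alternating_blocks b a) = b (+) ~~ odd (size a).
Proof.
elim: a b c => // k [|l a] IH b c _ /= /andP[k0 pa].
  by rewrite cats0 addbF; case: k k0 => //= k _; elim: k.
by rewrite last_cat IH //=; case: b; case: odd.
Qed.

Lemma cf_graphE a : cf_graph a = partial_snake (sign_seq a) (sumn a).-1.
Proof. by rewrite /cf_graph; have /cf_snakeE -> := cf_snakeP a. Qed.

Lemma num_dimer_covers_cf m a : (0 < size a)%N -> all (leq 1) a ->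
  (num_dimer_covers (cf_graph a) m)%:R =
  (\prod_(k <- a) (reversal m * transfer m ^+ k)) ord0 ord0.
Proof.
move=> a0 pa; rewrite cf_graphE -(size_alternating_blocks false) -/(sign_seq a).
have sz : (0 < size (sign_seq a))%N.
  rewrite size_alternating_blocks; case: a a0 pa => //= k a _ /andP[k0 _].
  by rewrite addn_gt0 k0.
rewrite num_dimer_covers_signs // last_alternating_blocks //.
rewrite prod_alternating_blocks.
have -> : nth false (sign_seq a) 0 = false by case: a {sz} a0 pa => [|[]].
rewrite !addFb expr0 mulr1 mul1r -!mulrA reversal_addb addbN addbb expr1.
(* The reversals left at the two ends turn each T^k J into J T^k. *)
congr (fun_of_matrix _ _ _); elim: a {a0 pa sz} => [|k a IH].
  by rewrite !big_nil mul1r reversalK.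
by rewrite !big_cons -!mulrA IH mulrA.
Qed.

(** The number of weakly decreasing chains of [a] steps that descend by [n] in
total, that is the binomial coefficient of [n + a - 1] over [n] for positive
[a]. The recursion sorts chains by what the last [a - 1] steps descend. *)
Fixpoint multichains (a n : nat) : nat :=
  if a is a'.+1 then \sum_(i < n.+1) multichains a' i else n == 0%N.

Lemma multichains0 a : multichains a 0 = 1%N.
Proof. by elim: a => //= a IH; rewrite big_ord1. Qed.

Lemma transferXE m a (x y : 'I_m.+1) :
  (transfer m ^+ a) x y = if (y <= x)%N then (multichains a (x - y))%:R else 0.
Proof.
elim: a x y => [|a IH] x y.
  by rewrite expr0 mxE -val_eqE /= subn_eq0; case: ltngtP.
rewrite exprS -mulmxE mxE.
case: leqP => [yx|xy]; last first.
  apply: big1 => z _; rewrite mxE IH; case: leqP => zx; last by rewrite mul0r.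
  by rewrite leqNgt (leq_ltn_trans zx xy) mulr0.
have -> : multichains a.+1 (x - y) = (\sum_(y <= z < x.+1) multichains a (z - y))%N.
  rewrite -[in RHS](add0n y) big_addn subSn // big_mkord /=.
  by apply: eq_bigr => i _; rewrite addnK.
rewrite big_geq_mkord natr_sum.
rewrite (big_ord_widen_cond m.+1 (fun z => y <= z)%N
           (fun z => (multichains a (z - y))%:R)) // [RHS]big_mkcond.
apply: eq_bigr => z _; rewrite mxE IH ltnS andbC.
by case: (z <= x)%N; rewrite ?mul1r ?mul0r.
Qed.

(** Both sides have entry [multichains k (m - i - j)], by the count of covers for
the single block [[k]] and multiplicity [m - i - j]. For negative [m - i - j]
there are no chains, and for [0] there is one. *)
Lemma Lambda_transfer m k : (0 < k)%N -> Lambda m k = reversal m * transfer m ^+ k.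
Proof.
move=> k0; apply/matrixP => i j; rewrite mxE -mulmxE reversal_mulE transferXE /=.
have im : (i <= m)%N by rewrite -ltnS.
rewrite subSS; case: leqP => [jm|mj].
  have -> : m%:Z - (i : nat)%:Z - (j : nat)%:Z = (m - i - j)%N by lia.
  case E: (m - i - j)%N => [|n] /=; first by rewrite multichains0.
  rewrite -natz num_dimer_covers_cf ?big_seq1 //= ?k0 //.
  by rewrite -mulmxE reversal_mulE transferXE /= subn0 subn1.
by have [n ->] : exists n, m%:Z - (i : nat)%:Z - (j : nat)%:Z = Negz n;
  first by exists (i + j - m).-1; lia.
Qed.

Theorem theorem1p1 (m : nat) (a : seq nat)
    (hm : (1 <= m)%N) (hn : (1 <= size a)%N)
    (ha : forall k : nat, k \in a -> (1 <= k)%N) :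
  (num_dimer_covers (cf_graph a) m)%:Z =
    (\prod_(k <- a) Lambda m k) ord0 ord0.
Proof.
rewrite -natz num_dimer_covers_cf //; last exact/allP.
congr (fun_of_matrix _ _ _); apply: eq_big_seq => k /ha k0.
by rewrite Lambda_transfer.
Qed.
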